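(* Let $\mathcal{B}=(S,\Sigma,\delta_{\mathcal{B}},I,F)$ be a may/must in the limit automaton (limMMAA). Let $\mathcal{T}=(M,\Sigma,\delta_{\mathcal{T}},m_I)$ be the semiautomaton of macrostates for $\mathcal{B}$, and let $\mathcal{Z}$ be the set of all $Z\subseteq S$ that contain only must-states and may-states reachable from must-states. With $\mathcal{GR}_Z=(\delta_{\mathcal{T}}\smallsetminus\mathrm{AT}_Z,\{\mathrm{AT}_Z^f\}_{f\in F\cap Z})$ as defined in the context, the transition-based generalized deterministic Rabin automaton $\mathcal{G}=(M,\Sigma,\delta_{\mathcal{T}},m_I,\{\mathcal{GR}_Z\mid Z\in\mathcal{Z}\})$ satisfies $L(\mathcal{G})=L(\mathcal{B})$.
   Context: Alphabet and words. An alphabet is a finite set $\Sigma=2^{AP'}$ with $AP'$ a finite set of atomic propositions; words are elements $w=w_0w_1\ldots\in\Sigma^\omega$. VWAA. A very weak alternating co-Büchi automaton (VWAA) is a tuple $(S,\Sigma,\delta,I,F)$ with $S$ a finite set of states (subsets $c\subseteq S$ are called configurations), $\delta\subseteq S\times\Sigma\times 2^S$, $I\subseteq 2^S$ a non-empty set of initial configurations, $F\subseteq S$ the co-Büchi accepting states, such that there is a partial order on $S$ where for every $(s,\alpha,c)\in\delta$ all states of $c$ are lower than or equal to $s$. A transition $(s,\alpha,c)$ is looping if $s\in c$, and a selfloop if $c=\{s\}$. A state $s'$ is reachable from $s$ if there are $s=s_0,\ldots,s_k=s'$ and transitions $(s_i,\alpha_i,c_i)\in\delta$ with $s_{i+1}\in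 c_i$ for $0\le i<k$. Multitransitions and runs. A multitransition $T$ with label $\alpha$ is a set of transitions, all labelled $\alpha$, with pairwise different source states (the empty set is a multitransition with any label). $\mathrm{dom}(T)$ is the set of source states of transitions in $T$; $\mathrm{range}(T)$ is the union of their target configurations. The multitransition relation is $\Delta=\{(\mathrm{dom}(T),\alpha,\mathrm{range}(T))\mid T \text{ a multitransition with label }\alpha\}$. A run over $w$ is an infinite sequence $\rho=T_0T_1\ldots$ of multitransitions with $\mathrm{dom}(T_0)\in I$, $T_i$ labelled by $w_i$, and $\mathrm{range}(T_i)=\mathrm{dom}(T_{i+1})$ for all $i\ge0$. The run is accepting if it has no suffix such that, for some $f\in F$, every multitransition of the suffix contains a looping transition from $f$. The language of the automaton is the set of words over which it has an accepting run. limMMAA. A may-state is a state with a selfloop for each $\alpha\in\Sigma$; a must-state is a state all of whose transitions are looping. A VWAA is a may/must in the limit automaton (limMMAA) if every state is a must-state, or a state without looping transitions, or a co-Büchi accepting state (element of $F$, not necessarily a may-state), and each state reachable from a must-state is either a must-state or a may-state. For $Z\subseteq S$, $\mathrm{must}(Z)$ is the set of must-states in $Z$. Semiautomata and TGDRA. A semiautomaton $(M,\Sigma,\delta,m_I)$ has a finite set of states $M$, an initial state $m_I$ and a deterministic transition relation $\delta\subseteq M\times\Sigma\times M$. Its run over $w$ is $\sigma(w)=(m_0,w_0,m_1)(m_1,w_1,m_2)\ldots\in\delta^\omega$ with $m_0=m_I$; $\mathit{Inf}_t(\sigma)$ is the set of transitions occurring infinitely often in $\sigma$. A transition-based generalized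 deterministic Rabin automaton (TGDRA) is a semiautomaton together with a finite set of generalized Rabin pairs $(K,\{L_j\}_{j\in J})$, $K,L_j\subseteq\delta$. A run $\sigma$ satisfies such a pair if $\mathit{Inf}_t(\sigma)\cap K=\emptyset$ and $\mathit{Inf}_t(\sigma)\cap L_j\ne\emptyset$ for each $j\in J$. A run is accepting if it satisfies some pair, and the language is the set of words $w$ such that $\sigma(w)$ is accepting. The semiautomaton $\mathcal{T}$ for $\mathcal{B}$. Let $\Delta_{\mathcal{B}}$ be the multitransition relation of $\mathcal{B}$. $\mathcal{T}=(M,\Sigma,\delta_{\mathcal{T}},m_I)$ where $m_I=I$; for a macrostate $m_1\subseteq 2^S$ and $\alpha\in\Sigma$ the unique $\alpha$-transition is $(m_1,\alpha,m_2)$ with $m_2=\bigcup_{c\in m_1}\{c'\mid (c,\alpha,c')\in\Delta_{\mathcal{B}}\}$; and $M\subseteq 2^{2^S}$ is the set of macrostates reachable from $m_I$. Acceptance. For $Z\subseteq S$: $\mathrm{AC}_Z=\{c\subseteq Z\mid \mathrm{must}(c)=\mathrm{must}(Z)\}$; $\mathrm{AT}_Z=\{(m_1,\alpha,m_2)\in\delta_{\mathcal{T}}\mid \exists c_1\in\mathrm{AC}_Z,\ \exists c_2\in m_2\cap\mathrm{AC}_Z:\ (c_1,\alpha,c_2)\in\Delta_{\mathcal{B}}\}$; for $f\in F\cap Z$, $\mathrm{AT}_Z^f=\{(m_1,\alpha,m_2)\in\mathrm{AT}_Z\mid \exists (f,\alpha,c)\in\delta_{\mathcal{B}}:\ f\notin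 c,\ c\subseteq Z\}$. *)

(* Defs.v *)
From mathcomp Require Import all_boot.

Set Implicit Arguments.
Unset Strict Implicit.
Unset Printing Implicit Defensive.

Definition word (AP : finType) := nat -> {set AP}.

(* A transition (s, alpha, c) of a VWAA, with letters in 2^AP. *)
Notation vtrans S AP := (S * {set AP} * {set S})%type.

Record vwaa (S AP : finType) := VWAA {
  vdelta : {set vtrans S AP};
  vinit : {set {set S}};
  vacc : {set S};
  vinit_neq0 : vinit != set0;
  vdelta_order : exists2 le : rel S,
    [/\ reflexive le, antisymmetric le & transitive le]
    & forall s a c, (s, a, c) \in vdelta -> forall s', s' \in c -> le s' s
}.

Section VWAA.
Variables (S AP : finType).
Implicit Types (B : vwaa S AP) (t : vtrans S AP) (T : {set vtrans S AP}).
Implicit Types (a : {set AP}) (s : S) (c Z : {set S}) (w : word AP).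

Definition vsrc t : S := t.1.1.
Definition vlabel t : {set AP} := t.1.2.
Definition vtarget t : {set S} := t.2.

Definition looping t : bool := vsrc t \in vtarget t.

Definition vstep B : rel S :=
  [rel s s' | [exists t in vdelta B, (vsrc t == s) && (s' \in vtarget t)]].

Definition vreachable B : rel S := connect (vstep B).

Definition multitransition B a T : bool :=
  [&& T \subset vdelta B,
      [forall t in T, vlabel t == a]
    & [forall t1 in T, forall t2 in T, (vsrc t1 == vsrc t2) ==> (t1 == t2)]].

Definition mdom T : {set S} := [set vsrc t | t in T].
Definition mrange T : {set S} := \bigcup_(t in T) vtarget t.

Definition mtrel B : {set {set S} * {set AP} * {set S}} :=
  [set (mdom p.2, p.1, mrange p.2)
     | p : {set AP} * {set vtrans S AP} & multitransition B p.1 p.2].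

Definition vrun B w (rho : nat -> {set vtrans S AP}) : Prop :=
  [/\ mdom (rho 0) \in vinit B,
      forall i, multitransition B (w i) (rho i)
    & forall i, mrange (rho i) = mdom (rho i.+1)].

Definition vrun_accepting B (rho : nat -> {set vtrans S AP}) : Prop :=
  ~ exists n, exists2 f, f \in vacc B &
      forall i, n <= i -> exists t, [/\ t \in rho i, vsrc t = f & looping t].

Definition vlang B w : Prop :=
  exists2 rho, vrun B w rho & vrun_accepting B rho.

Definition may_state B s : bool := [forall a, (s, a, [set s]) \in vdelta B].

Definition must_state B s : bool :=
  [forall t in vdelta B, (vsrc t == s) ==> looping t].

Definition loopless_state B s : bool :=
  [forall t in vdelta B, (vsrc t == s) ==> ~~ looping t].

Definition limMMAA B : Prop :=
  (forall s, [\/ must_state B s, loopless_state B s | s \in vacc B]) /\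
  (forall s s', must_state B s -> vreachable B s s' ->
     must_state B s' \/ may_state B s').

Definition must B Z : {set S} := [set s in Z | must_state B s].

End VWAA.

(* A transition (q, alpha, q') of a word automaton. *)
Notation strans Q AP := (Q * {set AP} * Q)%type.

(* Determinism includes totality, so that every word has exactly one run. *)
Record semiautomaton (Q AP : finType) := Semiautomaton {
  sdelta : {set strans Q AP};
  sinit : Q;
  sdelta_total : forall q a, exists q', (q, a, q') \in sdelta;
  sdelta_det : forall q a q1 q2,
    (q, a, q1) \in sdelta -> (q, a, q2) \in sdelta -> q1 = q2
}.

(* A generalized Rabin pair (K, {L_j}_j); the family {L_j}_j is represented by
   the set of its members. *)
Notation grpair Q AP := ({set strans Q AP} * {set {set strans Q AP}})%type.

Record tgdra (Q AP : finType) := TGDRA {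
  tsemi :> semiautomaton Q AP;
  tpairs : {set grpair Q AP};
  tpairs_sub : forall p, p \in tpairs ->
    p.1 \subset sdelta tsemi /\ forall L, L \in p.2 -> L \subset sdelta tsemi
}.

Section WordAutomata.
Variables (Q AP : finType).
Implicit Types (A : semiautomaton Q AP) (w : word AP).
Implicit Types (sigma : nat -> strans Q AP).

Definition snext A (q : Q) (a : {set AP}) : Q := xchoose (sdelta_total A q a).

Fixpoint srun_state A w n : Q :=
  if n is n'.+1 then snext A (srun_state A w n') (w n') else sinit A.

Definition srun A w (n : nat) : strans Q AP :=
  (srun_state A w n, w n, srun_state A w n.+1).

Definition inf_t sigma (t : strans Q AP) : Prop :=
  forall n, exists2 i, n <= i & sigma i = t.

Definition satisfies sigma (p : grpair Q AP) : Prop :=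
  (~ exists2 t, inf_t sigma t & t \in p.1) /\
  (forall L, L \in p.2 -> exists2 t, inf_t sigma t & t \in L).

Definition tlang (G : tgdra Q AP) w : Prop :=
  exists2 p, p \in tpairs G & satisfies (srun G w) p.

End WordAutomata.

Section Construction.
Variables (S AP : finType) (B : vwaa S AP).
Implicit Types (a : {set AP}) (c Z : {set S}) (f : S).

Definition macro_succ (m : {set {set S}}) a : {set {set S}} :=
  \bigcup_(c in m) [set c' | (c, a, c') \in mtrel B].

Definition macro_step : rel {set {set S}} :=
  [rel m1 m2 | [exists a, m2 == macro_succ m1 a]].

Definition macrostate : finType :=
  {m : {set {set S}} | connect macro_step (vinit B) m}.

Definition macro_init : macrostate :=
  Sub (vinit B) (connect0 macro_step (vinit B)).

Definition macro_delta : {set strans macrostate AP} :=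
  [set t | val t.2 == macro_succ (val t.1.1) t.1.2].

Lemma macro_delta_total (m : macrostate) a :
  exists m', (m, a, m') \in macro_delta.
Proof.
have Hm : connect macro_step (vinit B) (macro_succ (val m) a).
  apply: connect_trans (valP m) (connect1 _).
  by apply/existsP; exists a.
by exists (Sub (macro_succ (val m) a) Hm); rewrite inE /=.
Qed.

Lemma macro_delta_det (m : macrostate) a (m1 m2 : macrostate) :
  (m, a, m1) \in macro_delta -> (m, a, m2) \in macro_delta -> m1 = m2.
Proof.
rewrite !inE => /eqP H1 /eqP H2.
exact: val_inj (etrans H1 (esym H2)).
Qed.

Definition macro_semiautomaton : semiautomaton macrostate AP :=
  Semiautomaton macro_init macro_delta_total macro_delta_det.

Definition AC Z : {set {set S}} :=
  [set c : {set S} | (c \subset Z) && (must B c == must B Z)].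

(* The source configuration c1 is not required to belong to the macrostate. *)
Definition AT Z : {set strans macrostate AP} :=
  [set t in macro_delta |
     [exists c1 in AC Z, exists c2 in val t.2 :&: AC Z,
        (c1, t.1.2, c2) \in mtrel B]].

Definition ATf Z f : {set strans macrostate AP} :=
  [set t in AT Z |
     [exists c : {set S},
        [&& (f, t.1.2, c) \in vdelta B, f \notin c & c \subset Z]]].

Definition GR Z : grpair macrostate AP :=
  (macro_delta :\: AT Z, [set ATf Z f | f in vacc B :&: Z]).

Definition calZ : {set {set S}} :=
  powerset [set s | must_state B s ||
    (may_state B s && [exists s0, must_state B s0 && vreachable B s0 s])].

Lemma GR_sub p : p \in [set GR Z | Z in calZ] ->
  p.1 \subset sdelta macro_semiautomaton /\
  forall L, L \in p.2 -> L \subset sdelta macro_semiautomaton.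
Proof.
case/imsetP=> Z _ -> /=; split; first exact: subsetDl.
move=> L /imsetP[f _ ->]; apply/subsetP => t.
by rewrite inE => /andP[]; rewrite inE => /andP[].
Qed.

Definition macro_tgdra : tgdra macrostate AP := TGDRA GR_sub.

End Construction.

(* Main.v *)
Require Import Defs.
From mathcomp Require Import all_boot.
From mathcomp.classical Require Import boolp.

Set Implicit Arguments.
Unset Strict Implicit.
Unset Printing Implicit Defensive.

(** From an accepting run of B, let Z be the set of states occurring infinitely
    often. A state of Z that is not entered infinitely often from a different
    (hence larger) state of Z loops forever, so it is not in F, hence a
    must-state; by induction along the order every state of Z is reachable from
    a must-state. As must-states never disappear from a run, the configurations
    are eventually in AC_Z, and each f in F and Z is left infinitely often.

    Conversely, if the run of T is eventually in AT_Z, one reaches some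
    configuration of AC_Z and never leaves AC_Z by letting must-states imitate
    the transitions that witness AT_Z, letting f exit whenever AT_Z^f permits
    it, and letting all other may-states take their selfloops. *)

(** * Properties that recur along a sequence *)

Definition infinitely_often (P : nat -> Prop) : Prop :=
  forall n, exists2 i, n <= i & P i.

Lemma not_infinitely_often (P : nat -> Prop) :
  ~ infinitely_often P -> exists n, forall i, n <= i -> ~ P i.
Proof.
by move=> /existsNP[n nP]; exists n => i ni Pi; apply: nP; exists i.
Qed.

Lemma infinitely_often_pigeonhole (T : finType) (P : T -> nat -> Prop) :
  infinitely_often (fun i => exists x, P x i) ->
  exists x, infinitely_often (P x).
Proof.
move=> ioP; apply: contrapT => /forallNP nioP.
have /choice[f fP] x := not_infinitely_often (nioP x).
have [i le_i [x Pxi]] := ioP (\max_x f x).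
by apply: (fP x i) Pxi; apply: leq_trans le_i; apply: leq_bigmax.
Qed.

(** There are finitely many transitions, so by pigeonhole one of [L] recurs as soon as [L] is
    visited at arbitrarily late positions. Rabin conditions thus become conditions on positions. *)
Lemma infinitely_often_inf_t (Q AP : finType) (sigma : nat -> strans Q AP)
    (L : {set strans Q AP}) :
  (exists2 t, inf_t sigma t & t \in L) <->
  infinitely_often (fun i => sigma i \in L).
Proof.
split=> [[t inft tL] n|ioL].
  by have [i ni it] := inft n; exists i => //; rewrite it.
have [n|t iot] := @infinitely_often_pigeonhole _
  (fun t i => sigma i = t /\ t \in L).
  by have [i ni iL] := ioL n; exists i => //; exists (sigma i).
have [_ _ [_ tL]] := iot 0.
by exists t => // n; have [i ni []] := iot n; exists i.
Qed.

Lemma srun_delta (Q AP : finType) (A : semiautomaton Q AP) (w : word AP) n :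
  srun A w n \in sdelta A.
Proof. exact: xchooseP (sdelta_total A _ _). Qed.

(** * Multitransitions and the configurations of [AC] *)

Section Multitransitions.
Variables (S AP : finType) (B : vwaa S AP).
Implicit Types (a : {set AP}) (s : S) (c Z : {set S}) (T : {set vtrans S AP}).

Lemma multitransition_dom a T s :
    multitransition B a T -> s \in mdom T ->
  exists c, [/\ (s, a, c) \in T, (s, a, c) \in vdelta B & c \subset mrange T].
Proof.
case/and3P=> /subsetP sub /forall_inP lab _ /imsetP[[[s' a'] c] tT /= ->].
exists c; have /eqP <- := lab _ tT; split=> //; first exact: sub.
exact: (bigcup_sup (s', a', c)).
Qed.

Lemma multitransition_range a T s :
    multitransition B a T -> s \in mrange T ->
  exists s' c,
    [/\ (s', a, c) \in T, (s', a, c) \in vdelta B, s' \in mdom T & s \in c].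
Proof.
case/and3P=> /subsetP sub /forall_inP lab _ /bigcupP[[[s' a'] c] tT /= sc].
exists s', c; have /eqP <- := lab _ tT; split=> //; first exact: sub.
by apply/imsetP; exists (s', a', c).
Qed.

Lemma mtrelP c a c' :
  reflect (exists T, [/\ multitransition B a T, mdom T = c & mrange T = c'])
          ((c, a, c') \in mtrel B).
Proof.
apply: (iffP imsetP) => [[[a' T]]|[T [TB <- <-]]].
  by rewrite inE /= => TB [-> -> ->]; exists T.
by exists (a, T) => //; rewrite inE.
Qed.

(** Choosing one transition as a function of its source makes the sources pairwise different. *)
Lemma multitransition_choose a c (P : S -> {set S} -> Prop) :
    (forall s, s \in c -> exists2 c', (s, a, c') \in vdelta B & P s c') ->
  exists T, [/\ multitransition B a T, mdom T = c
              & forall t, t \in T -> P (vsrc t) (vtarget t)].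
Proof.
move=> H; have /choice[g gP] s :
    exists c', s \in c -> (s, a, c') \in vdelta B /\ P s c'.
  by case: (boolP (s \in c)) => [/H[c' ? ?]|_]; [exists c' | exists set0].
exists [set (s, a, g s) | s in c]; split.
- apply/and3P; split.
  + by apply/subsetP => _ /imsetP[s /gP[? _] ->].
  + by apply/forall_inP => _ /imsetP[s _ ->].
  + apply/forall_inP => _ /imsetP[s1 _ ->].
    apply/forall_inP => _ /imsetP[s2 _ ->].
    by apply/implyP => /eqP; rewrite /vsrc /= => ->.
- apply/setP => s; apply/imsetP/idP => [[_ /imsetP[s' ? ->] ->] //|sc].
  by exists (s, a, g s) => //; apply: imset_f.
- by move=> _ /imsetP[s /gP[_ ?] ->].
Qed.

Lemma must_stateP s a c : must_state B s -> (s, a, c) \in vdelta B -> s \in c.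
Proof. by move=> /forall_inP H /H; rewrite /= eqxx. Qed.

Lemma must_range a T s :
  multitransition B a T -> must_state B s -> s \in mdom T -> s \in mrange T.
Proof.
move=> TB ms /(multitransition_dom TB)[c [_ /(must_stateP ms) sc /subsetP]].
exact.
Qed.

Lemma ACP Z c :
  reflect (c \subset Z /\ forall s, s \in Z -> must_state B s -> s \in c)
          (c \in Defs.AC B Z).
Proof.
rewrite inE; apply: (iffP andP) => -[cZ H]; split=> //.
  move=> s sZ ms; move/eqP/setP/(_ s): H.
  by rewrite !inE sZ ms andbT.
apply/eqP/setP => s; rewrite !inE; case ms: (must_state B s); rewrite ?andbF //.
by rewrite !andbT; apply/idP/idP => [/(subsetP cZ)|/H->].
Qed.

End Multitransitions.

Lemma srun_state_macro (S AP : finType) (B : vwaa S AP) (w : word AP) n :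
  let q := srun_state (macro_semiautomaton B) w in
  val (q n.+1) = macro_succ B (val (q n)) (w n).
Proof.
by move=> q; have := srun_delta (macro_semiautomaton B) w n; rewrite inE => /eqP.
Qed.

(** * From an accepting run of [B] to Rabin acceptance *)

Section RunToRabin.
Variables (S AP : finType) (B : vwaa S AP) (hB : limMMAA B).
Variables (w : word AP) (rho : nat -> {set vtrans S AP}).
Hypotheses (rhoB : vrun B w rho) (rho_acc : vrun_accepting B rho).

Let rho_multi i : multitransition B (w i) (rho i).
Proof. by case: rhoB. Qed.

Let rho_next i : mrange (rho i) = mdom (rho i.+1).
Proof. by case: rhoB. Qed.

Definition recurrent_states : {set S} :=
  [set s | `[< infinitely_often (fun i => s \in mdom (rho i)) >]].
Local Notation Z := recurrent_states.

Lemma recurrentP s :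
  reflect (infinitely_often (fun i => s \in mdom (rho i))) (s \in Z).
Proof. by rewrite inE; apply: asboolP. Qed.

Definition entered_from s s' i : Prop :=
  s' != s /\ exists2 c, (s', w i, c) \in rho i & s \in c.

(** From [n] on, [s] can only be inherited from itself by a looping transition. Such a transition
    occurs at every step, which excludes a loopless state and, by acceptance, a state of
    [vacc B]. *)
Lemma must_of_eventually_not_entered s n :
    s \in Z -> (forall i, n <= i -> ~ exists s', entered_from s s' i) ->
  must_state B s.
Proof.
move=> /recurrentP sZ not_entered.
have loop_back i : n <= i -> s \in mdom (rho i.+1) ->
    exists2 c, (s, w i, c) \in rho i & s \in c.
  move=> ni; rewrite -rho_next.
  case/(multitransition_range (rho_multi i)) => s' [c [cT _ _ sc]].
  have [E|ns] := eqVneq s' s; first by rewrite E in cT; exists c.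
  by case: (not_entered i ni); exists s'; split=> //; exists c.
have back k i : n <= i -> s \in mdom (rho (i + k)) -> s \in mdom (rho i).
  elim: k i => [|k IH] i ni; first by rewrite addn0.
  have nik : n <= i + k := leq_trans ni (leq_addr _ _).
  rewrite addnS => /(loop_back _ nik)[c cT _].
  by apply: IH => //; apply/imsetP; exists (s, w (i + k), c).
have loop i : n <= i -> exists2 c, (s, w i, c) \in rho i & s \in c.
  (* Recurrence gives an occurrence of [s] after [i], which [back] carries down to [i.+1]. *)
  move=> ni; apply: loop_back => //; have [j ij sj] := sZ i.+1.
  by apply: (back (j - i.+1)); [apply: leqW | rewrite subnKC].
case: (hB.1 s) => // [/forall_inP nl|sF].
  have [c cT sc] := loop n (leqnn n).
  case/and3P: (rho_multi n) => /subsetP/(_ _ cT)/nl.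
  by rewrite /Defs.looping /= eqxx sc.
case: rho_acc; exists n, s => // i /loop[c cT sc].
by exists (s, w i, c); split.
Qed.

Lemma recurrent_reachable_from_must s :
  s \in Z -> exists2 s0, must_state B s0 & vreachable B s0 s.
Proof.
have [le [le_refl le_anti le_trans] leB] := vdelta_order B.
(* Induction on the number of states above [s]: it drops when [s] is replaced by a strictly larger
   state that enters [s] infinitely often. *)
have [m] := ubnP #|[set s' | le s s']|.
elim: m s => // m IH s; rewrite ltnS => le_m sZ.
have [io_entered|/not_infinitely_often[n nE]] :=
    EM (infinitely_often (fun i => exists s', entered_from s s' i)); last first.
  by exists s; [apply: must_of_eventually_not_entered nE | apply: connect0].
have [s' s'E] := infinitely_often_pigeonhole io_entered.
have [i _ [ns [c cT sc]]] := s'E 0.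
have cB : (s', w i, c) \in vdelta B.
  by case/and3P: (rho_multi i) => /subsetP/(_ _ cT).
have les : le s s' := leB _ _ _ cB _ sc.
have [||s0 ms0 s0s'] := IH s'.
- apply: leq_trans le_m; apply: proper_card; apply/properP; split.
    by apply/subsetP => x; rewrite !inE; apply: le_trans.
  exists s; rewrite !inE //; apply: contra ns => les'.
  by apply/eqP/le_anti; rewrite les les'.
- apply/recurrentP => k; have [j kj [_ [c' c'T _]]] := s'E k; exists j => //.
  by apply/imsetP; exists (s', w j, c').
exists s0 => //; apply: connect_trans s0s' (connect1 _).
by apply/existsP; exists (s', w i, c); rewrite cB /= eqxx.
Qed.

Lemma recurrent_calZ : Z \in calZ B.
Proof.
rewrite inE; apply/subsetP => s /recurrent_reachable_from_must[s0 ms0 s0s].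
rewrite inE; have [->//|may] := hB.2 _ _ ms0 s0s.
by apply/orP; right; rewrite may; apply/existsP; exists s0; rewrite ms0.
Qed.

Lemma must_persistent s i j :
  must_state B s -> i <= j -> s \in mdom (rho i) -> s \in mdom (rho j).
Proof.
move=> ms /subnKC <- si; elim: (j - i) => [|k IH]; first by rewrite addn0.
by rewrite addnS -rho_next; apply: must_range (rho_multi _) ms IH.
Qed.

(** Otherwise a single state is bad infinitely often. It is then recurrent, so it must be a
    must-state that is absent after having occurred, against [must_persistent]. *)
Lemma eventually_AC : exists n, forall i, n <= i -> mdom (rho i) \in Defs.AC B Z.
Proof.
pose bad s i := s \in mdom (rho i) /\ s \notin Z \/
  [/\ s \in Z, must_state B s & s \notin mdom (rho i)].
have [io_bad|/not_infinitely_often[n nbad]] :=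
    EM (infinitely_often (fun i => exists s, bad s i)); last first.
  exists n => i ni; apply/ACP; split=> [|s sZ ms].
    by apply/subsetP => s si; apply: contrapT => /negP sZ; case: (nbad i ni);
       exists s; left.
  by apply: contrapT => /negP si; case: (nbad i ni); exists s; right.
have [s sbad] := infinitely_often_pigeonhole io_bad.
have /recurrentP sZ : s \in Z.
  apply: contrapT => nsZ; apply: (nsZ); apply/recurrentP => n.
  by have [i ni [[si _]|[]]] := sbad n => //; exists i.
have [i _ si] := sZ 0.
have [j ij [[_ /recurrentP//]|[_ ms /negP[]]]] := sbad i.
exact: must_persistent ms ij si.
Qed.

Lemma recurrent_acc_left f : f \in vacc B -> f \in Z ->
  infinitely_often (fun i => exists c, (f, w i, c) \in rho i /\ f \notin c).
Proof.
move=> fF /recurrentP fZ n; have [i ni fi] := fZ n; apply: contrapT => stay.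
(* If [f] is never left after [i], each occurrence of [f] reproduces itself by looping, against
   acceptance. *)
suff loop k : f \in mdom (rho (i + k)) /\
    exists2 c, (f, w (i + k), c) \in rho (i + k) & f \in c.
  case: rho_acc; exists i, f => // j /subnKC <-.
  by have [_ [c cT fc]] := loop (j - i); exists (f, w (i + (j - i)), c); split.
have loop_at j : i <= j -> f \in mdom (rho j) ->
    exists2 c, (f, w j, c) \in rho j & f \in c.
  move=> ij /(multitransition_dom (rho_multi j))[c [cT _ _]]; exists c => //.
  apply: contrapT => /negP fc; case: stay; exists j; first exact: leq_trans ij.
  by exists c.
elim: k => [|k [IH [c cT fc]]].
  by rewrite addn0; split=> //; apply: loop_at.
have fk : f \in mdom (rho (i + k.+1)).
  by rewrite addnS -rho_next; apply/bigcupP; exists (f, w (i + k), c).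
by split=> //; apply: loop_at; rewrite ?leq_addr.
Qed.

Lemma mdom_in_macrostate i :
  mdom (rho i) \in val (srun_state (macro_semiautomaton B) w i).
Proof.
elim: i => [|i IH]; first by case: rhoB.
rewrite srun_state_macro; apply/bigcupP; exists (mdom (rho i)) => //.
by rewrite inE; apply/mtrelP; exists (rho i); split.
Qed.

Lemma tlang_of_accepting_run : tlang (macro_tgdra B) w.
Proof.
have [N AC_N] := eventually_AC.
have AT_N i : N <= i -> srun (macro_semiautomaton B) w i \in AT B Z.
  move=> Ni; rewrite inE (srun_delta (macro_semiautomaton B)) /=.
  apply/exists_inP; exists (mdom (rho i)); first exact: AC_N.
  apply/exists_inP; exists (mdom (rho i.+1)).
    by rewrite inE (mdom_in_macrostate i.+1) AC_N // leqW.
  by apply/mtrelP; exists (rho i); split.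
exists (GR B Z); first by apply: imset_f; apply: recurrent_calZ.
split=> [/infinitely_often_inf_t/(_ N)[i Ni]|_ /imsetP[f + ->]].
  by rewrite inE AT_N.
rewrite inE => /andP[fF fZ]; apply/infinitely_often_inf_t => n.
have [i] := recurrent_acc_left fF fZ (maxn n N).
rewrite geq_max => /andP[ni Ni] [c [cT fc]]; exists i => //.
rewrite inE AT_N //=; apply/existsP; exists c; rewrite fc /=.
case/and3P: (rho_multi i) => /subsetP/(_ _ cT) -> _ _ /=.
(* The exit [c] of [f] lies in the next configuration, which is already inside [Z]. *)
have /ACP[sub _] : mdom (rho i.+1) \in Defs.AC B Z by apply: AC_N; apply: leqW.
by apply: subset_trans sub; rewrite -rho_next; apply: (bigcup_sup (f, w i, c)).
Qed.

End RunToRabin.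

(** * From Rabin acceptance to an accepting run of [B] *)

Section RabinToRun.
Variables (S AP : finType) (B : vwaa S AP) (w : word AP).
Local Notation sigma := (srun (macro_semiautomaton B) w).
Local Notation macro n := (val (srun_state (macro_semiautomaton B) w n)).

(** Membership in a macrostate is traced back to [vinit B], prepending one multitransition at a
    time. *)
Lemma extend_to_run n (rho' : nat -> {set vtrans S AP}) :
    mdom (rho' 0) \in macro n ->
    (forall i, multitransition B (w (n + i)) (rho' i)) ->
    (forall i, mrange (rho' i) = mdom (rho' i.+1)) ->
  exists2 rho, vrun B w rho & forall i, rho (n + i) = rho' i.
Proof.
elim: n rho' => [|n IH] rho' dom0 multi next; first by exists rho'.
move: dom0; rewrite srun_state_macro.
case/bigcupP => c cn; rewrite inE => /mtrelP[T [TB domT rangeT]].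
have [|i|i|rho rhoB rhoE] := IH (fun i => if i is j.+1 then rho' j else T).
- by rewrite domT.
- by case: i => [|i]; rewrite ?addn0 // addnS -addSn.
- by case: i.
by exists rho => // i; rewrite addSnnS rhoE.
Qed.

Variable Z : {set S}.

(** The last conjunct asks every source to exit when [ATf] permits it. A must-state is never
    concerned, as all its transitions loop. *)
Definition good_step c (t : strans (macrostate B) AP) T : bool :=
  [&& multitransition B t.1.2 T, mdom T == c, mrange T \in Defs.AC B Z
    & [forall u in T, (t \in ATf B Z (vsrc u)) ==> ~~ Defs.looping u]].

(** The witness [c1] of [AT] may differ from [c], but both contain all must-states of [Z], so [T1]
    has a transition to copy for each must-state of [c]. *)
Lemma good_step_exists c t :
    Z \in calZ B -> c \in Defs.AC B Z -> t \in AT B Z ->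
  exists T, good_step c t T.
Proof.
rewrite inE => /subsetP ZmM /ACP[/subsetP cZ must_c] tAT.
have [c1 /ACP[_ must_c1] [T1 [T1B dom1 range1]]] : exists2 c1, c1 \in Defs.AC B Z &
    exists T1, [/\ multitransition B t.1.2 T1, mdom T1 = c1 & mrange T1 \subset Z].
  move: tAT; rewrite inE => /andP[_ /exists_inP[c1 c1AC /exists_inP[c2]]].
  rewrite inE => /andP[_ /ACP[c2Z _]] /mtrelP[T1 [T1B dom1 range1]].
  by exists c1 => //; exists T1; rewrite range1.
have [s sc|T [TB domT PT]] := multitransition_choose (B := B) (a := t.1.2)
    (c := c) (P := fun s c' => c' \subset Z /\ (t \in ATf B Z s -> s \notin c')).
  have [tf|ntf] := boolP (t \in ATf B Z s).
    move: tf; rewrite inE => /andP[_ /existsP[c' /and3P[? ? ?]]].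
    by exists c'.
  have := ZmM s (cZ s sc); rewrite inE => /orP[ms|/andP[/forallP may_s _]].
    have : s \in mdom T1 by rewrite dom1 must_c1 // cZ.
    case/(multitransition_dom T1B) => c' [_ c'B c'r].
    by exists c' => //; split=> //; apply: subset_trans range1.
  by exists [set s] => //; split=> //; rewrite sub1set cZ.
exists T; rewrite /good_step TB domT eqxx /=; apply/andP; split.
  apply/ACP; split; first by apply/bigcupsP => u /PT[].
  by move=> s sZ ms; apply: (must_range TB ms); rewrite domT must_c.
by apply/forall_inP => u /PT[_ H]; apply/implyP.
Qed.

Variable n : nat.

Definition pick_step c i : {set vtrans S AP} :=
  (* The default [set0] is never taken along [tail_config], which stays in [AC]. *)
  odflt set0 [pick T | good_step c (sigma (n + i)) T].

Fixpoint tail_config c i : {set S} :=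
  if i is j.+1 then mrange (pick_step (tail_config c j) j) else c.

Lemma accepting_run_of_AT c :
    Z \in calZ B -> c \in macro n -> c \in Defs.AC B Z ->
    (forall i, n <= i -> sigma i \in AT B Z) ->
    (forall f, f \in vacc B -> f \in Z ->
       infinitely_often (fun i => sigma i \in ATf B Z f)) ->
  vlang B w.
Proof.
move=> ZcalZ cn cAC AT_n ATf_io.
have step_good d i : d \in Defs.AC B Z -> good_step d (sigma (n + i)) (pick_step d i).
  move=> dAC; rewrite /pick_step; case: pickP => //= nT.
  have [|T] := good_step_exists ZcalZ dAC (AT_n (n + i) _); first exact: leq_addr.
  by rewrite nT.
have tailAC i : tail_config c i \in Defs.AC B Z.
  by elim: i => //= i /(step_good _ i)/and4P[].
pose rho' i := pick_step (tail_config c i) i.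
have good i : good_step (tail_config c i) (sigma (n + i)) (rho' i).
  exact: step_good.
have dom' i : mdom (rho' i) = tail_config c i.
  by case/and4P: (good i) => _ /eqP.
have [||i|rho rhoB rhoE] := @extend_to_run n rho'.
- by rewrite dom'.
- by move=> i; case/and4P: (good i).
- by rewrite dom'.
exists rho => // -[k [f fF loop]].
have fZ : f \in Z.
  (* Position [n + k] is past both the prefix of length [n] and the start [k] of the supposed
     endless looping. *)
  have [u [uT uf _]] := loop (n + k) (leq_addl _ _).
  have /ACP[/subsetP sub _] := tailAC k; apply: sub.
  by rewrite -dom' -rhoE -uf; apply: imset_f.
(* At such a [j] the good step makes [f] exit, while [loop] provides a looping transition from
   [f]. *)
have [j] := ATf_io f fF fZ (n + k) => nkj fj.
have [u [uT uf lu]] := loop j (leq_trans (leq_addl _ _) nkj).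
have nj : n <= j := leq_trans (leq_addr _ _) nkj.
have /and4P[_ _ _ /forall_inP/(_ u)] := good (j - n).
by rewrite -rhoE subnKC // uf fj lu => /(_ uT).
Qed.

End RabinToRun.

Lemma tlang_sub_vlang (S AP : finType) (B : vwaa S AP) (w : word AP) :
  tlang (macro_tgdra B) w -> vlang B w.
Proof.
case=> _ /imsetP[Z ZcalZ ->] [/infinitely_often_inf_t K L].
have [n nK] := not_infinitely_often K.
have AT_n i : n <= i -> srun (macro_semiautomaton B) w i \in AT B Z.
  move=> ni; apply: contrapT => /negP nAT; apply: (nK i ni).
  by rewrite inE nAT (srun_delta (macro_semiautomaton B)).
(* Only the target witness of [AT] is known to lie in a macrostate, so the tail starts from it, at
   position [n.+1]. *)
have := AT_n n (leqnn n); rewrite inE => /andP[_ /exists_inP[c1 _]].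
case/exists_inP=> c; rewrite inE => /andP[cn cAC] _.
apply: (accepting_run_of_AT ZcalZ cn cAC) => [i ni|f fF fZ].
  by apply: AT_n; apply: ltnW.
by apply/infinitely_often_inf_t/L/imset_f; rewrite inE fF.
Qed.

Theorem mainTheorem3 (AP S : finType) (B : vwaa S AP) (hB : limMMAA B) :
  forall w : word AP, tlang (macro_tgdra B) w <-> vlang B w.
Proof.
move=> w; split=> [|[rho rhoB rho_acc]]; first exact: tlang_sub_vlang.
exact: (tlang_of_accepting_run hB rhoB).
Qed.
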